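(* Let $X$ be a set, $\mathbb{M}$ a set of membership functions on $X$, and $\mathbf{L}=(\mathbb{M},\vee,\wedge,\neg,0,1;\leq)$ a fuzzy subset logic whose operations $(\wedge,\vee)$ are pointwise evaluated. Suppose there exist $\mathfrak{m}\in\mathbb{M}$ and $p\in X$ such that $(\neg\mathfrak{m})(p)=\mathfrak{m}(p)\in(0,1)$. Then: (A) if $\mathfrak{n}\vee\neg\mathfrak{n}=1$ for all $\mathfrak{n}\in\mathbb{M}$ (excluded middle), then $\mathfrak{m}\vee\mathfrak{m}\neq\mathfrak{m}$; (B) if $\mathfrak{n}\wedge\neg\mathfrak{n}=0$ for all $\mathfrak{n}\in\mathbb{M}$ (non-contradiction), then $\mathfrak{m}\wedge\mathfrak{m}\neq\mathfrak{m}$.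
   Context: A membership function on $X$ is a function $X\to[0,1]$. A lattice $(Y,\vee,\wedge;\leq)$ is a partial order in which every pair has a join (least upper bound) $\vee$ and meet (greatest lower bound) $\wedge$; it is bounded with least element $0$ and greatest element $1$. A function $\neg:Y\to Y$ on a bounded lattice is a minimal negation if it is antitone ($x\leq y\Rightarrow\neg y\leq\neg x$) and $x\leq\neg\neg x$ for all $x$; it is a fuzzy negation if moreover $\neg1=0$. A function $\rightarrow:Y\times Y\to Y$ is an implication if (1) $x\leq y$ implies $x\rightarrow y\geq x\vee y$ and (2) $x\wedge(x\rightarrow y)\leq\neg x\vee y$ for all $x,y$. A fuzzy logic is a bounded lattice with a fuzzy negation $\neg$ and an implication $\rightarrow$. A fuzzy subset logic is a fuzzy logic $(\mathbb{M},\vee,\wedge,\neg,0,1;\leq,\rightarrow)$ whose underlying set $\mathbb{M}$ is a set of membership functions. The pair $(\wedge,\vee)$ is pointwise evaluated if there exist $f,g:[0,1]^2\to[0,1]$ such that $(\mathfrak{m}\wedge\mathfrak{n})(x)=f(\mathfrak{m}(x),\mathfrak{n}(x))$ and $(\mathfrak{m}\vee\mathfrak{n})(x)=g(\mathfrak{m}(x),\mathfrak{n}(x))$ for all $x\in X$ and all $\mathfrak{m},\mathfrak{n}\in\mathbb{M}$.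
   Formalization: The bounds 0 and 1 of the fuzzy subset logic are assumed to be the constant membership functions 0 and 1; for arbitrary least and greatest elements the claim fails, e.g. for M consisting only of the constant function 1/2. *)

(* Defs.v *)
From HB Require Import structures.
From mathcomp Require Import all_boot all_order all_algebra.
From mathcomp Require Import boolp classical_sets functions reals.
From mathcomp Require Import interval_inference.

Set Implicit Arguments.
Unset Strict Implicit.
Unset Printing Implicit Defensive.

Import Order.TTheory GRing.Theory Num.Theory.
Local Open Scope order_scope.

Section FuzzyLogic.
Context {d : Order.disp_t} {Y : tbLatticeType d}.
Implicit Types (neg : Y -> Y) (imp : Y -> Y -> Y).

Definition minimal_negation neg : Prop :=
  (forall x y, x <= y -> neg y <= neg x) /\ (forall x, x <= neg (neg x)).

Definition fuzzy_negation neg : Prop :=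
  minimal_negation neg /\ neg \top = \bot.

Definition implication neg imp : Prop :=
  (forall x y, x <= y -> x `|` y <= imp x y) /\
  (forall x y, x `&` imp x y <= neg x `|` y).

End FuzzyLogic.

Record fuzzyLogic (d : Order.disp_t) (Y : tbLatticeType d) := FuzzyLogic {
  fl_neg : Y -> Y;
  fl_imp : Y -> Y -> Y;
  fl_negP : fuzzy_negation fl_neg;
  fl_impP : implication fl_neg fl_imp
}.

Definition membershipFun (X : Type) (R : realType) : Type := X -> {i01 R}.

(* The order is an arbitrary bounded lattice order on the subtype of elements
   of M; it need not be the pointwise one.  The bounds 0 and 1 of the logic are
   the constant membership functions: for unspecified bounds, a lattice reduced
   to the constant function 1/2 would satisfy excluded middle and
   non-contradiction, with a self-negated value at every point. *)
Record fuzzySubsetLogic (d : Order.disp_t) (X : Type) (R : realType)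
    (M : set (membershipFun X R)) := FuzzySubsetLogic {
  fsl_class : Order.TBLattice d M;
  fsl_lattice : tbLatticeType d := Order.TBLattice.Pack fsl_class;
  fsl_logic : fuzzyLogic fsl_lattice;
  fsl_botE : forall x : X, \val (\bot : fsl_lattice) x = (0%:i01)%R;
  fsl_topE : forall x : X, \val (\top : fsl_lattice) x = (1%:i01)%R
}.
Coercion fsl_lattice : fuzzySubsetLogic >-> Order.TBLattice.type.

Section FuzzySubsetLogicTheory.
Context {d : Order.disp_t} {X : Type} {R : realType}.
Context {M : set (membershipFun X R)}.
Variable L : fuzzySubsetLogic d M.

Definition mu (m : L) : membershipFun X R := \val (m : M).

Definition neg (m : L) : L := fl_neg (fsl_logic L) m.

Definition pointwise_evaluated : Prop :=
  exists f g : {i01 R} -> {i01 R} -> {i01 R}, forall (m n : L) (x : X),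
    mu (m `&` n) x = f (mu m x) (mu n x) /\
    mu (m `|` n) x = g (mu m x) (mu n x).

Definition excluded_middle : Prop := forall n : L, n `|` neg n = \top.

Definition non_contradiction : Prop := forall n : L, n `&` neg n = \bot.

End FuzzySubsetLogicTheory.

(* Main.v *)
(* At p the functions m and neg m take the same value, so pointwise evaluation
   cannot distinguish m `|` m from m `|` neg m = \top there: (m `|` m) p = 1,
   whereas m p < 1.  Dually for the meet. *)
Require Import Defs.
From HB Require Import structures.
From mathcomp Require Import all_boot all_order all_algebra.
From mathcomp Require Import boolp classical_sets functions reals.
From mathcomp Require Import interval_inference.
Import Order.TTheory GRing.Theory Num.Theory.

Theorem theorem1p28 (d : Order.disp_t) (X : Type) (R : realType)
    (M : set (membershipFun X R)) (L : fuzzySubsetLogic d M)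
    (hL : pointwise_evaluated L)
    (m : L) (p : X) (hfix : mu (neg m) p = mu m p)
    (hp : (0 < (mu m p)%:num < 1)%R) :
  (excluded_middle L -> (m `|` m)%O <> m) /\
  (non_contradiction L -> (m `&` m)%O <> m).
Proof.
have [f [g fgE]] := hL; have /andP[mp_gt0 mp_lt1] := hp.
have [meetE joinE] := fgE m (neg m) p.
have [meet_mmE join_mmE] := fgE m m p.
(* This eliminates [f] and [g]: [meetE] and [joinE] now say that at [p] combining [m] with [neg m]
   gives the same value as combining [m] with itself. *)
rewrite hfix -meet_mmE in meetE; rewrite hfix -join_mmE in joinE.
split=> [em mm | nc mm].
(* [mm] is used backwards to expand [m] into its self-join, which [joinE] and [em] turn into [\top],
   the constant function 1. *)
- have mp1 : mu m p = 1%:i01%R by rewrite -[in LHS]mm -joinE em; exact: fsl_topE.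
  by rewrite mp1 ltxx in mp_lt1.
(* Dually, the self-meet leads to [\bot], the constant function 0. *)
- have mp0 : mu m p = 0%:i01%R by rewrite -[in LHS]mm -meetE nc; exact: fsl_botE.
  by rewrite mp0 ltxx in mp_gt0.
Qed.
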